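(* There is an absolute constant $n_0$ such that the following holds. Let $T$ be a tree with $n\ge n_0$ vertices and maximum degree $\Delta$. Suppose that $T$ has at most $n/(\log n)^3$ leaves and let $v$ be an arbitrary vertex of $T$. Let $G$ be an $n$-vertex graph with $\delta(G)\ge n-n/(\Delta(\log n)^5)$ and let $x\in V(G)$. If $p\ge\Delta(\log n)^5/n$, then with probability at least $1-n^{-3}$ there is an embedding of $T$ into $G_p$ that maps $v$ to $x$.
   Context: For a graph $G$ and $p\in[0,1]$, $G_p$ is the random subgraph of $G$ obtained by keeping each edge independently with probability $p$. An embedding of $T$ into $H$ is an injective map $V(T)\to V(H)$ sending edges to edges. $\log$ denotes the natural logarithm. *)

(* Defs.v *)
From mathcomp Require Import all_boot all_order all_algebra.

Set Implicit Arguments.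
Unset Strict Implicit.
Unset Printing Implicit Defensive.

Import GRing.Theory.

Record sgraph (V : finType) := SGraph {
  adj :> rel V;
  adj_sym : symmetric adj;
  adj_irr : irreflexive adj
}.

Section Graphs.
Variable V : finType.
Implicit Type G : sgraph V.

Definition degree G (u : V) : nat := #|[set w | G u w]|.

Definition max_degree G : nat := \max_(u : V) degree G u.

(* Every degree is below #|V|, so the default value #|V| is only reached on
   the empty graph. *)
Definition min_degree G : nat := \big[minn/#|V|]_(u : V) degree G u.

Definition leaves G : {set V} := [set u | degree G u == 1].

(* ucycle: a closed walk without repeated vertices. A single edge {u, w} yields
   the "cycle" [:: u; w], so genuine cycles are those of length at least 3. *)
Definition acyclic G : Prop := forall c : seq V, ucycle G c -> size c <= 2.

Definition is_tree G : Prop :=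
  [/\ 0 < #|V|, (forall u w : V, connect G u w) & acyclic G].

Definition edges G : {set {set V}} :=
  [set [set uw.1; uw.2] | uw : V * V & G uw.1 uw.2].

Definition keep_adj G (S : {set {set V}}) : rel V :=
  fun u w => G u w && ([set u; w] \in S).

Lemma keep_sym G S : symmetric (keep_adj G S).
Proof. by move=> u w; rewrite /keep_adj adj_sym setUC. Qed.

Lemma keep_irr G S : irreflexive (keep_adj G S).
Proof. by move=> u; rewrite /keep_adj adj_irr. Qed.

Definition keep G (S : {set {set V}}) : sgraph V :=
  SGraph (keep_sym G S) (keep_irr G S).

(* The probability that G_p satisfies A: the kept edge set S ranges over the
   subsets of edges G, weighted by the product law in which each edge is kept
   with probability p independently of the others. *)
Definition prob_Gp (R : nzRingType) (G : sgraph V) (p : R)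
    (A : pred (sgraph V)) : R :=
  (\sum_(S : {set {set V}} | (S \subset edges G) && A (keep G S))
     \prod_(e in edges G) (if e \in S then p else 1 - p))%R.

End Graphs.

Definition embedding (V W : finType) (T : sgraph V) (H : sgraph W)
    (f : V -> W) : bool :=
  injectiveb f && [forall u, forall w, T u w ==> H (f u) (f w)].

Definition embeds_rooted (V W : finType) (T : sgraph V) (v : V) (x : W)
    (H : sgraph W) : bool :=
  [exists f : {ffun V -> W}, embedding T H f && (f v == x)].

(* Main.v *)
Require Import Defs.
From mathcomp Require Import all_boot all_order all_algebra.
From mathcomp Require Import fingroup perm.
From mathcomp Require Import reals sequences exp.
From mathcomp Require Import ring lra.

(* Consider the copies of T in G that send v to x. Swapping the images of two
   vertices of such a copy almost always gives another one, because a vertex u of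
   T is blocked by at most 2 * Delta * codegree other vertices. Repeated switching
   at leaves of a set Y of edges shows that the uniform measure on the copies is
   q-spread: a proportion at most q^|Y| of them contains Y, for
   q = e^12 * Delta * log n / n. Hence any family of edge sets covering all copies
   has cost (the sum of q^|Y|) at least 1.

   The Park-Pham argument turns this into containment of a copy in a random
   subset of the edges. Given the edges W revealed so far, each copy S
   is replaced by a fragment S' \ W of least size, with S' a copy inside S u W.
   The fragments that are at least half as large as allowed have small expected
   total cost, so they cannot cover, and the maximal size halves in each round.
   After k ~ log n rounds a copy is present with probability at least 1/2; 2k
   independent repetitions give failure probability at most n^-3. All this takes
   p of order k^3 * q, i.e. Delta * (log n)^4 / n. *)

Set Implicit Arguments.
Unset Strict Implicit.
Unset Printing Implicit Defensive.

Import Order.TTheory GRing.Theory Num.Theory.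

Local Open Scope ring_scope.

(** * Product laws on the subsets of a finite set *)

Section RandomSubsets.
Variables (R : realFieldType) (E : finType).
Implicit Types (P : E -> R) (A B C : {set E}) (f g : {set E} -> R).

Definition weight P A : R := \prod_e (if e \in A then P e else 1 - P e).

Definition expect P f : R := \sum_A weight P A * f A.

Lemma prodrD_set P Q :
  \prod_e (P e + Q e) = \sum_(A : {set E}) \prod_e (if e \in A then P e else Q e).
Proof. by rewrite bigA_distr; apply: eq_bigl => A; rewrite inE. Qed.

Lemma weight_ge0 P A : (forall e, 0 <= P e <= 1) -> 0 <= weight P A.
Proof.
move=> P01; apply: prodr_ge0 => e _.
by case/andP: (P01 e) => P0 P1; case: ifP => // _; rewrite subr_ge0.
Qed.

Lemma sum_weight P : \sum_A weight P A = 1.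
Proof.
rewrite /weight -prodrD_set.
by apply: big1 => e _; rewrite addrC subrK.
Qed.

Lemma ler_expect P f g : (forall e, 0 <= P e <= 1) ->
  (forall A, f A <= g A) -> expect P f <= expect P g.
Proof.
by move=> P01 fg; apply: ler_sum => A _; apply: ler_wpM2l (fg A); exact: weight_ge0.
Qed.

Lemma expect_cst P c : expect P (fun=> c) = c.
Proof. by rewrite /expect -big_distrl /= sum_weight mul1r. Qed.

Lemma expectD P f g : expect P (fun A => f A + g A) = expect P f + expect P g.
Proof. by rewrite /expect -big_split; apply: eq_bigr => A _; rewrite mulrDr. Qed.

Lemma expectZ P c f : expect P (fun A => c * f A) = c * expect P f.
Proof. by rewrite /expect big_distrr; apply: eq_bigr => A _; rewrite mulrCA. Qed.

Lemma expect_ge0 P f : (forall e, 0 <= P e <= 1) -> (forall A, 0 <= f A) -> 0 <= expect P f.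
Proof. by move=> P01 f0; rewrite -(expect_cst P 0); apply: ler_expect. Qed.

Lemma expect_le1 P f : (forall e, 0 <= P e <= 1) -> (forall A, f A <= 1) -> expect P f <= 1.
Proof. by move=> P01 f0; rewrite -[leRHS](expect_cst P 1); apply: ler_expect. Qed.

Lemma eq_expect P Q f : P =1 Q -> expect P f = expect Q f.
Proof.
by move=> PQ; apply: eq_bigr => A _; congr (_ * _); apply: eq_bigr => e _; rewrite PQ.
Qed.

Lemma natr_eqU A B C :
  (A :|: B == C)%:R = \prod_e (((e \in A) || (e \in B)) == (e \in C))%:R :> R.
Proof.
case: eqP => [<-|neq]; first by rewrite big1 // => e _; rewrite in_setU eqxx.
have [e neq_e] : exists e, ((e \in A) || (e \in B)) != (e \in C).
  apply/existsP; rewrite -negb_forall; apply/negP => /forallP eqABC.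
  by apply: neq; apply/setP => e; rewrite in_setU; apply/eqP.
by rewrite (bigD1 e) //= (negbTE neq_e) mul0r.
Qed.

(** The indicator of [A :|: B = C] factors over the coordinates, so the sums over [A] and [B] can be
    carried out one coordinate at a time. *)
Lemma expect_union P Q f :
  expect P (fun A => expect Q (fun B => f (A :|: B))) =
  expect (fun e => P e + Q e - P e * Q e) f.
Proof.
pose h A B C := \prod_e ((if e \in A then P e else 1 - P e) *
  (if e \in B then Q e else 1 - Q e) * (((e \in A) || (e \in B)) == (e \in C))%:R).
transitivity (\sum_A \sum_B \sum_C h A B C * f C).
  apply: eq_bigr => A _; rewrite big_distrr /=; apply: eq_bigr => B _.
  rewrite (bigD1 (A :|: B)) //= big1 => [|C neqC]; last first.
    by rewrite /h 2!big_split /= -natr_eqU eq_sym (negbTE neqC) mulr0 mul0r.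
  by rewrite addr0 /h 2!big_split /= -natr_eqU eqxx /= mulr1 mulrA.
rewrite (eq_bigr (fun A => \sum_C \sum_B h A B C * f C)); last by move=> A _; exact: exchange_big.
rewrite exchange_big; apply: eq_bigr => C _ /=.
rewrite (eq_bigr (fun A => (\sum_B h A B C) * f C)); last by move=> A _; rewrite big_distrl.
rewrite -big_distrl /=; congr (_ * _).
pose k e (a b : bool) := (if a then P e else 1 - P e) *
  (if b then Q e else 1 - Q e) * ((a || b) == (e \in C))%:R.
transitivity (\sum_(A : {set E}) \prod_e
    (if e \in A then k e true true + k e true false else k e false true + k e false false)).
  apply: eq_bigr => A _.
  rewrite (eq_bigr (fun e => k e (e \in A) true + k e (e \in A) false)); last first.
    by move=> e _; case: (e \in A).
  rewrite prodrD_set; apply: eq_bigr => B _.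
  by apply: eq_bigr => e _; rewrite /k; case: (e \in B).
rewrite -prodrD_set.
by apply: eq_bigr => e _; rewrite /k /=; case: (e \in C); rewrite /=; ring.
Qed.

(* The larger random set is the smaller one enriched by an independent one. *)
Lemma expect_antitone P Q f : (forall e, 0 <= P e) -> (forall e, P e <= Q e <= 1) ->
  (forall A B, A \subset B -> f B <= f A) -> expect Q f <= expect P f.
Proof.
move=> P0 PQ fanti.
(* [S] solves [P e + S e - P e * S e = Q e]. Where [P e = 1], division by zero yields [S e = 0],
   which is right because [Q e = 1] too. *)
pose S e := (Q e - P e) / (1 - P e).
have P01 e : 0 <= P e <= 1.
  by rewrite P0; case/andP: (PQ e) => /le_trans h /h.
have S01 e : 0 <= S e <= 1.
  case/andP: (P01 e) => _; case/andP: (PQ e) => PQe Q1; rewrite /S.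
  rewrite le_eqVlt => /orP[/eqP ->|P1]; first by rewrite subrr invr0 mulr0 lexx ler01.
  rewrite divr_ge0 ?subr_ge0 ?(ltW P1) //= ler_pdivrMr ?subr_gt0 //; lra.
have -> : expect Q f = expect (fun e => P e + S e - P e * S e) f.
  apply: eq_expect => e; rewrite /S; case/andP: (PQ e) => PQe Q1.
  have [P1|nP1] := eqVneq (P e) 1; last first.
    by have ? : 1 - P e != 0 by [rewrite subr_eq0 eq_sym]; field.
  by rewrite P1 subrr invr0; lra.
rewrite -expect_union; apply: ler_expect => // A.
rewrite -(expect_cst S (f A)); apply: ler_expect => // B.
by apply: fanti; rewrite subsetUl.
Qed.

End RandomSubsets.

(** * Minimum fragments of a family of sets *)

Section Fragments.
Variable E : finType.
Implicit Types (H U : {set {set E}}) (S T W Z : {set E}).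

Definition covers U H : Prop := forall S, S \in H -> exists2 T, T \in U & T \subset S.

Definition avoids H W : bool := [forall S in H, ~~ (S \subset W)].

Definition fragment H S W : {set E} :=
  [arg min_(S' < S | (S' \in H) && (S' \subset S :|: W)) #|S' :\: W|] :\: W.

Lemma fragmentP H S W : S \in H ->
  exists S', [/\ S' \in H, S' \subset S :|: W, fragment H S W = S' :\: W &
    forall S'', S'' \in H -> S'' \subset S :|: W -> #|fragment H S W| <= #|S'' :\: W|]%N.
Proof.
move=> SH; rewrite /fragment; case: arg_minnP => [|S' /andP[S'H S'SW] S'min].
  by rewrite SH subsetUl.
by exists S'; split=> // S'' S''H S''SW; apply: S'min; rewrite S''H.
Qed.

Lemma fragment_sub H S W : S \in H -> fragment H S W \subset S.
Proof. by case/(fragmentP W) => S' [_ S'SW -> _]; rewrite subDset setUC. Qed.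

Lemma fragment_disjoint H S W : [disjoint fragment H S W & W].
Proof. by rewrite -setI_eq0 setIDAC setDIl setDv setI0. Qed.

(** As the fragment lies in [S], such an [S'] competes in the minimum defining it; [S' :\: W] is
    contained in the fragment and no smaller, hence equal to it. *)
Lemma fragment_sub_mem H S W S' : S \in H -> S' \in H ->
  S' \subset W :|: fragment H S W -> fragment H S W \subset S'.
Proof.
move=> SH S'H S'sub.
have [_ [_ _ _ fmin]] := fragmentP W SH.
have S'SW : S' \subset S :|: W.
  by apply: subset_trans S'sub _; rewrite setUC setSU // fragment_sub.
have sub : S' :\: W \subset fragment H S W by rewrite subDset.
have /eqP <- : S' :\: W == fragment H S W by rewrite eqEcard sub fmin.
exact: subsetDl.
Qed.

Definition mem_within H Z : {set E} := odflt set0 [pick S in H | S \subset Z].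

Lemma fragment_sub_within H S W : S \in H ->
  fragment H S W \subset mem_within H (W :|: fragment H S W).
Proof.
move=> SH; rewrite /mem_within; case: pickP => [S' /andP[S'H] | none] /=.
  exact: fragment_sub_mem.
have [S' [S'H _ fE _]] := fragmentP W SH.
by have := none S'; rewrite S'H fE -subDset subxx.
Qed.

Lemma card_mem_within H Z m : (forall S, S \in H -> #|S| < m)%N -> (0 < m)%N ->
  (#|mem_within H Z| < m)%N.
Proof.
move=> Hm m0; rewrite /mem_within; case: pickP => [S /andP[/Hm]|] //=.
by rewrite cards0.
Qed.

Definition fragments (Q : pred nat) H W : {set {set E}} :=
  [set fragment H S W | S in [set S in H | Q #|fragment H S W|]].

(** A fragment inside [B] would complete a member of [H] inside [W :|: B]. *)
Lemma avoids_fragments H Q W B : avoids H (W :|: B) -> avoids (fragments Q H W) B.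
Proof.
move=> /forall_inP avoid; apply/forall_inP => T /imsetP[S]; rewrite inE => /andP[SH _] ->.
have [S' [S'H _ -> _]] := fragmentP W SH.
by apply: contra (avoid _ S'H); rewrite subDset.
Qed.

Lemma covers_fragments H W m U :
  covers U (fragments (fun i => i < m)%N H W) ->
  covers (U :|: fragments (leq m) H W) H.
Proof.
move=> cov S SH; case: (ltnP #|fragment H S W| m) => cardf.
  have /cov [T TU Tsub] : fragment H S W \in fragments (fun i => i < m)%N H W.
    by apply: imset_f; rewrite inE SH cardf.
  by exists T; [rewrite inE TU | apply: subset_trans Tsub _; exact: fragment_sub].
exists (fragment H S W); last exact: fragment_sub.
by rewrite inE; apply/orP; right; apply: imset_f; rewrite inE SH cardf.
Qed.

End Fragments.

(** * Rounds of fragments and the threshold bound *)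

Section Threshold.
Variables (R : realFieldType) (E : finType) (X : {set E}).
Implicit Types (H U : {set {set E}}) (S T W Z : {set E}) (p q : R).

Definition only p (e : E) : R := if e \in X then p else 0.

Lemma only01 p e : 0 <= p <= 1 -> 0 <= only p e <= 1.
Proof. by rewrite /only; case: ifP => // _ _; rewrite lexx ler01. Qed.

Definition cost q U : R := \sum_(T in U) q ^+ #|T|.

Lemma cost_ge0 q U : 0 <= q -> 0 <= cost q U.
Proof. by move=> q0; apply: sumr_ge0 => T _; apply: exprn_ge0. Qed.

Lemma costU q U U' : 0 <= q -> cost q (U :|: U') <= cost q U + cost q U'.
Proof.
move=> q0; rewrite /cost [leLHS](big_setID U) /= setUK setDUl setDv set0U lerD2l.
by rewrite [leRHS](big_setID U) /= setIC lerDr; exact: cost_ge0.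
Qed.

(** On [T] the set [W :|: T] collects the factor [p ^+ #|T|] and [W] at most 1; elsewhere the
    factors agree. *)
Lemma weight_only_setU p W T : 0 <= p <= 1 -> T \subset X -> [disjoint T & W] ->
  weight (only p) W * p ^+ #|T| <= weight (only p) (W :|: T).
Proof.
move=> p01 TX TW; rewrite /weight (bigID (mem T)) /= [leRHS](bigID (mem T)) /=.
set a := \prod_(e in T) _; set b := \prod_(_ | _) _; set c := \prod_(e in T) _.
set d := \prod_(_ | _) _.
have -> : d = b.
  by apply: eq_bigr => e eT; rewrite in_setU (negbTE eT) orbF.
have -> : c = p ^+ #|T|.
  rewrite /c -prodr_const; apply: eq_bigr => e eT.
  by rewrite in_setU eT orbT /only (subsetP TX).
have b0 : 0 <= b.
  apply: prodr_ge0 => e _; have /andP[P0 P1] := only01 e p01.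
  by case: ifP => // _; rewrite subr_ge0.
have p0 : 0 <= p ^+ #|T| by case/andP: p01 => p0 _; exact: exprn_ge0.
have a1 : a <= 1.
  rewrite /a; apply: prodr_ile1 => e _; have /andP[P0 P1] := only01 e p01.
  by case: ifP => _; rewrite ?P0 ?P1 // subr_ge0 P1 lerBlDr lerDl P0.
by have := ler_wpM2l (mulr_ge0 p0 b0) a1; rewrite mulr1 mulrC mulrA mulrAC.
Qed.

(* A fragment [T] of [W] is determined by [Z = W :|: T] up to the choice of a
   subset of the one set [mem_within H Z], and trading [W] for [Z] gains a
   factor [p ^+ #|T|] in the weight. *)
Lemma expect_cost_fragments p q H m :
  0 <= q -> 0 < p <= 1 -> 4 * q <= p -> (0 < m)%N ->
  (forall S, S \in H -> S \subset X) -> (forall S, S \in H -> #|S| < m.*2)%N ->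
  expect (only p) (fun W => cost q (fragments (leq m) H W)) <= 4 * (q / p).
Proof.
move=> q0 /andP[p0 p1] qp m0 HX Hm.
have p01 : 0 <= p <= 1 by rewrite ltW.
pose r := q / p.
have r0 : 0 <= r by rewrite divr_ge0 // ltW.
have r1 : 4 * r <= 1 by rewrite mulrA ler_pdivrMr // mul1r.
have w0 W : 0 <= weight (only p) W by apply: weight_ge0 => e; exact: only01.
pose big Z T := (T \subset mem_within H Z) && (m <= #|T|)%N.
have step1 : expect (only p) (fun W => cost q (fragments (leq m) H W)) <=
    \sum_T \sum_(W | T \in fragments (leq m) H W) weight (only p) (W :|: T) * r ^+ #|T|.
  rewrite (exchange_big_dep xpredT) //=; apply: ler_sum => W _.
  rewrite mulr_sumr; apply: ler_sum => T /imsetP[S]; rewrite inE => /andP[SH _] ->.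
  set f := fragment H S W.
  have := weight_only_setU p01 (subset_trans (fragment_sub W SH) (HX _ SH))
    (fragment_disjoint H S W).
  rewrite -/f => le_w.
  have -> : q ^+ #|f| = p ^+ #|f| * r ^+ #|f|.
    by rewrite -exprMn /r mulrC divfK // gt_eqF.
  by rewrite mulrA; apply: ler_wpM2r => //; exact: exprn_ge0.
apply: (le_trans step1).
(* Since fragments are disjoint from [W], sending [W] to [W :|: T] is injective here, and its values
   [Z] all satisfy [big Z T]. *)
have step2 T : \sum_(W | T \in fragments (leq m) H W) weight (only p) (W :|: T) * r ^+ #|T| <=
    \sum_(Z | big Z T) weight (only p) Z * r ^+ #|T|.
  pose A := [set W | T \in fragments (leq m) H W].
  rewrite (eq_bigl (fun W => W \in A)); last by move=> W; rewrite inE.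
  have inj : {in A &, injective (fun W => W :|: T)}.
    have setDK W : W \in A -> (W :|: T) :\: T = W.
      rewrite inE => /imsetP[S _ ->]; rewrite setDUl setDv setU0; apply/setDidPl.
      by rewrite disjoint_sym fragment_disjoint.
    by move=> W W' /setDK eW /setDK eW' eqWT; rewrite -eW eqWT.
  rewrite -(big_imset (fun Z => weight (only p) Z * r ^+ #|T|) inj) /=.
  rewrite [leRHS](bigID (mem ((fun W => W :|: T) @: A))) /=.
  rewrite [X in X + _](eq_bigl (mem ((fun W => W :|: T) @: A))); last first.
    move=> Z; rewrite andb_idl // => /imsetP[W]; rewrite inE => /imsetP[S].
    rewrite inE => /andP[SH mS] TE ->; rewrite /big TE mS andbT.
    exact: fragment_sub_within.
  by rewrite lerDl; apply: sumr_ge0 => Z _; rewrite mulr_ge0 // exprn_ge0.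
apply: (le_trans (ler_sum _ (fun T _ => step2 T))).
rewrite (exchange_big_dep xpredT) //= -[leRHS](expect_cst (only p)).
apply: ler_sum => Z _; rewrite -mulr_sumr; apply: ler_wpM2l => //.
set S := mem_within H Z.
have cS : (#|S| <= m + m)%N by rewrite addnn ltnW // card_mem_within // double_gt0.
(* For [t >= m >= 1] and [4 * r <= 1], [r ^+ t = (4 * r) ^+ t / 4 ^+ t] is at most [4 * r / 4 ^+ m],
   and at most [2 ^ (2 * m) = 4 ^ m] sets [T] occur. *)
apply: (@le_trans _ _ (\sum_(T | big Z T) 4 * r / 4 ^+ m)).
  apply: ler_sum => T /andP[_ mT].
  have -> : r ^+ #|T| = (4 * r) ^+ #|T| / 4 ^+ #|T|.
    by rewrite -expr_div_n; congr (_ ^+ _); field.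
  have r40 : 0 <= 4 * r by rewrite mulr_ge0.
  apply: ler_pM; rewrite ?exprn_ge0 ?invr_ge0 ?exprn_ge0 //.
    case: #|T| (leq_trans m0 mT) => // t _.
    by rewrite exprS ler_piMr // exprn_ile1.
  by rewrite lef_pV2 ?posrE ?exprn_gt0 // ler_eXn2l // (ltr_nat _ 1).
have r4m : 0 <= 4 * r / 4 ^+ m.
  by apply: divr_ge0; [exact: mulr_ge0 | exact: exprn_ge0].
apply: (@le_trans _ _ (\sum_(T in powerset S) 4 * r / 4 ^+ m)).
  rewrite [leRHS](bigID (big Z)) /= [X in _ <= X + _](eq_bigl (big Z)); last first.
    by move=> T; rewrite powersetE andb_idl // => /andP[].
  by rewrite lerDl; apply: sumr_ge0.
rewrite sumr_const card_powerset -[leLHS]mulr_natl natrX -[leRHS]mulr1 mulrCA.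
apply: ler_wpM2l; first exact: mulr_ge0.
rewrite ler_pdivrMr ?exprn_gt0 // mul1r.
have -> : 4 = 2 ^+ 2 :> R by rewrite expr2 -natrM.
by rewrite -exprM ler_weXn2l ?ler1n // mul2n -addnn.
Qed.

Lemma avoids_le1 H W : (avoids H W)%:R <= 1 :> R.
Proof. by case: avoids; rewrite ?ler01. Qed.

Definition evasion H p : R := expect (only p) (fun W => (avoids H W)%:R).

Lemma evasion_ge0 H p : 0 <= p <= 1 -> 0 <= evasion H p.
Proof. by move=> p01; apply: expect_ge0 => [e|W]; [exact: only01 | exact: ler0n]. Qed.

Lemma evasion_le1 H p : 0 <= p <= 1 -> evasion H p <= 1.
Proof. by move=> p01; apply: expect_le1 => [e|W]; [exact: only01 | exact: avoids_le1]. Qed.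

(** The density of a union of [k] independent [p]-random sets. *)
Definition repeated p k : R := 1 - (1 - p) ^+ k.

Lemma repeated01 p k : 0 <= p <= 1 -> 0 <= repeated p k <= 1.
Proof.
case/andP=> p0 p1; rewrite /repeated subr_ge0 lerBlDr lerDl.
have q0 : 0 <= 1 - p by rewrite subr_ge0.
by rewrite exprn_ge0 // exprn_ile1 // lerBlDr lerDl.
Qed.

Lemma evasion_repeatedD H p j k :
  evasion H (repeated p (j + k)) =
  expect (only (repeated p j)) (fun A =>
    expect (only (repeated p k)) (fun B => (avoids H (A :|: B))%:R)).
Proof.
rewrite (expect_union _ _ (fun W => (avoids H W)%:R)); apply: eq_expect => e.
rewrite /only /repeated.
by case: (e \in X); rewrite ?exprD; ring.
Qed.

(** Induction on [k], revealing one [p]-random round [W] per step. Fragments of size at least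
    [2 ^ k] lower the covering cost by at most [4 * (q / p)] on average; the smaller ones fall under
    the induction hypothesis. As this loss is random, [c] is arbitrary, possibly negative. *)
Lemma evasion_iterate p q k H c :
  0 <= q -> 0 < p <= 1 -> 4 * q <= p ->
  (forall S, S \in H -> S \subset X) -> (forall S, S \in H -> #|S| < 2 ^ k)%N ->
  (forall U, covers U H -> c <= cost q U) ->
  c * evasion H (repeated p k) <= 4 * (q / p) * k%:R.
Proof.
move=> q0 p01' qp; have p01 : 0 <= p <= 1 by case/andP: p01' => /ltW ->.
have qp0 : 0 <= 4 * (q / p) by rewrite mulr_ge0 // divr_ge0 //; case/andP: p01.
elim: k H c => [|k IH] H c HX Hk Hc.
  (* An empty [H] is covered at no cost, so [c <= 0]; otherwise [H] contains the empty set, which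
     nothing avoids. *)
  rewrite mulr0; have [H0|[S SH]] := set_0Vmem H.
    have c0 : c <= 0.
      by have := Hc set0; rewrite /cost big_set0 => h; apply: h => S; rewrite H0 inE.
    by rewrite mulr_le0_ge0 // evasion_ge0 // repeated01.
  rewrite /evasion /expect big1 ?mulr0 // => W _; rewrite [avoids H W](_ : _ = false) ?mulr0 //.
  apply/negbTE/forall_inPn; exists S => //; rewrite negbK.
  by have := Hk S SH; rewrite ltnS leqn0 cards_eq0 => /eqP ->; rewrite sub0set.
have [c0|/ltW c0] := lerP c 0.
  apply: (@le_trans _ _ 0); last by rewrite mulr_ge0.
  by rewrite mulr_le0_ge0 // evasion_ge0 // repeated01.
rewrite -add1n evasion_repeatedD natrD mulrDr mulr1.
have -> : expect (only (repeated p 1)) =1 expect (only p).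
  by move=> f; apply: eq_expect => e; rewrite /only /repeated expr1 subKr.
rewrite -expectZ.
have cost_frag : expect (only p) (fun W => cost q (fragments (leq (2 ^ k)) H W)) <= 4 * (q / p).
  apply: expect_cost_fragments => //; first by rewrite expn_gt0.
  by move=> S /Hk; rewrite expnS mul2n.
(* The expected cost replaces one summand [4 * (q / p)], so that the claim can be proved for each
   fixed [W]. *)
apply: le_trans (lerD cost_frag (lexx _)).
rewrite -[X in _ + X](expect_cst (only p)) -expectD.
apply: ler_expect => [e|W]; first exact: only01.
set H' := fragments (fun i => i < 2 ^ k)%N H W.
have avoidsH' B : avoids H (W :|: B) -> avoids H' B by exact: avoids_fragments.
apply: (@le_trans _ _ (c * evasion H' (repeated p k))).
  apply: ler_wpM2l => //; apply: ler_expect => [e|B]; first exact/only01/repeated01.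
  by rewrite ler_nat; case: (avoids H _) (@avoidsH' B) => // ->.
have := IH H' (c - cost q (fragments (leq (2 ^ k)) H W)).
have H'X S : S \in H' -> S \subset X.
  case/imsetP=> T; rewrite inE => /andP[TH _] ->.
  exact: subset_trans (fragment_sub _ TH) (HX _ TH).
have H'k S : S \in H' -> (#|S| < 2 ^ k)%N.
  by case/imsetP=> T; rewrite inE => /andP[TH cT] ->.
move=> /(_ H'X H'k); rewrite mulrBl lerBlDr => /(_ _) IH'.
rewrite addrC; apply: (le_trans (IH' _)) => [U /covers_fragments /Hc cU|].
  by rewrite lerBlDr; apply: le_trans cU _; exact: costU.
rewrite lerD2l ler_piMr ?cost_ge0 // evasion_le1 // repeated01 //.
Qed.

Lemma evasion_boost H p j k : 0 <= p <= 1 ->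
  evasion H (repeated p (j * k)) <= evasion H (repeated p k) ^+ j.
Proof.
move=> p01; elim: j => [|j IH].
  by rewrite mul0n expr0 evasion_le1 // repeated01.
rewrite mulSn evasion_repeatedD exprSr.
have [s0 s1] := (repeated01 k p01, repeated01 (j * k) p01).
apply: le_trans (ler_wpM2r (evasion_ge0 H s0) IH); rewrite -expectZ.
apply: ler_expect => [e|A]; first exact: only01.
rewrite [leRHS]mulrC -expectZ; apply: ler_expect => [e|B]; first exact: only01.
rewrite -natrM mulnb ler_nat; case: (boolP (avoids H (A :|: B))) => // /forall_inP avoid.
have -> // : avoids H A && avoids H B.
by apply/andP; split; apply/forall_inP => S /avoid; apply: contra => /subset_trans -> //;
   rewrite ?subsetUl ?subsetUr.
Qed.

Lemma evasion_antitone H p p' : 0 <= p -> p <= p' <= 1 -> evasion H p' <= evasion H p.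
Proof.
move=> p0 pp'; apply: expect_antitone => [e|e|A B AB].
- by rewrite /only; case: ifP.
- by rewrite /only; case: ifP; rewrite // lexx ler01.
- rewrite ler_nat; case: (boolP (avoids H B)) => // /forall_inP avoid.
  rewrite [avoids H A](_ : _ = true) //; apply/forall_inP => S /avoid.
  by apply: contra => /subset_trans ->.
Qed.

Lemma repeated_le p k : 0 <= p <= 1 -> repeated p k <= k%:R * p.
Proof.
move=> p01; rewrite /repeated; elim: k => [|k IH]; first by rewrite expr0 subrr mul0r.
have /andP[s0 s1] := repeated01 k p01.
case/andP: p01 => p0 _; have := mulr_ge0 p0 s0.
by rewrite exprSr -natr1 /repeated; lra.
Qed.

(* [k] rounds of probability [p / (2 * k ^ 2)] fail with probability at most
   [1 / 2]; they are repeated [2 * k] times. *)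
Lemma threshold p q k H : (0 < k)%N ->
  0 <= q -> 0 < p <= 1 -> 16 * k%:R ^+ 3 * q <= p ->
  (forall S, S \in H -> S \subset X) -> (forall S, S \in H -> #|S| < 2 ^ k)%N ->
  (forall U, covers U H -> 1 <= cost q U) ->
  evasion H p <= 4 ^- k.
Proof.
move=> k0 q0 /andP[p0 p1] qp HX Hk Hc.
have kR : 1 <= k%:R :> R by rewrite ler1n.
have k2 : 0 < 2 * k%:R ^+ 2 :> R by rewrite mulr_gt0 // exprn_gt0 // (lt_le_trans ltr01).
pose p' := p / (2 * k%:R ^+ 2).
have p'0 : 0 < p' by rewrite divr_gt0.
have k21 : 1 <= 2 * k%:R ^+ 2 :> R by nra.
have p'1 : p' <= 1 by rewrite ler_pdivrMr // mul1r (le_trans p1).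
have p'01 : 0 <= p' <= 1 by rewrite ltW.
(* This makes the bound [4 * (q / p') * k] of [evasion_iterate] at most 1/2. *)
have qp' : 8 * k%:R * q <= p'.
  by rewrite ler_pdivlMr //; apply: le_trans qp; rewrite le_eqVlt; apply/orP; left; apply/eqP; ring.
have half : evasion H (repeated p' k) <= 2^-1.
  have := @evasion_iterate p' q k H 1 q0; rewrite p'0 p'1 mul1r => /(_ isT) /=.
  move=> iter; apply: le_trans (iter _ HX Hk Hc) _.
    by apply: le_trans qp'; rewrite ler_wpM2r //; lra.
  rewrite mulrAC mulrA ler_pdivrMr //; lra.
have le_p : repeated p' ((2 * k) * k) <= p.
  apply: le_trans (repeated_le _ p'01) _; rewrite /p' -mulnA mulnn natrM natrX.
  by rewrite mulrC divfK // gt_eqF.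
have /andP[s0 _] := repeated01 ((2 * k) * k) p'01.
apply: (@le_trans _ _ (evasion H (repeated p' ((2 * k) * k)))).
  by apply: evasion_antitone => //; rewrite le_p.
apply: le_trans (evasion_boost H _ _ p'01) _.
have -> : 4 ^- k = (2^-1) ^+ (2 * k) :> R.
  by rewrite exprVn exprM expr2 -natrM.
by apply: lerXn2r; rewrite ?nnegrE ?invr_ge0 // evasion_ge0 // repeated01.
Qed.

End Threshold.

Local Open Scope nat_scope.

(** * Leaves of a forest away from a given vertex *)

Section ForestLeaf.
Variables (V : finType) (e : rel V).
Hypotheses (e_sym : symmetric e) (e_irr : irreflexive e).
Hypothesis e_acyclic : forall c : seq V, ucycle e c -> size c <= 2.

(** Prolong the path as long as possible: a further neighbour of its end cannot lie on the path, as
    this would close a cycle, so the process stops at a vertex of degree one. *)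
Lemma path_end_leaf s p z :
  path e s (rcons p z) -> uniq (s :: rcons p z) ->
  exists z' y, [/\ z' != s, e z' y & forall y', e z' y' -> y' = y].
Proof.
have [n] := ubnP (#|V| - size p); elim: n p z => // n IH p z lt_n spz uspz.
have ezl : e z (last s p) by move: spz; rewrite rcons_path e_sym => /andP[].
case: (pickP [pred y | e z y && (y != last s p)]) => [y /= /andP[ezy yl]|none]; last first.
  exists z, (last s p); split=> // [|y ezy].
    by move: uspz; rewrite /= mem_rcons inE negb_or eq_sym => /andP[/andP[]].
  by apply/eqP; have := none y; rewrite /= ezy /= => /negbFE.
have yz : y != z by apply: contraTneq ezy => ->; rewrite e_irr.
case: (boolP (y \in s :: rcons p z)) => [|yspz]; last first.
  have u' : uniq (s :: rcons (rcons p z) y) by rewrite -rcons_cons rcons_uniq yspz.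
  apply: (IH (rcons p z) y) => //; last by rewrite rcons_path spz last_rcons.
  have := max_card (mem (s :: rcons p z)); rewrite (card_uniqP uspz) /= !size_rcons.
  by move=> /ltnW sp; apply: leq_trans (ltn_sub2l sp (leqnn _)) _.
rewrite -rcons_cons mem_rcons inE (negbTE yz) /= => ysp.
(* [y] and the rest of the path up to [z] form a cycle, of length at least 3 because [y] is not the
   predecessor of [z]. *)
exfalso; move: spz uspz yl; case/splitPl: ysp => p1 p2 lastp1.
rewrite rcons_cat -cat_cons cat_uniq cat_path lastp1 last_cat lastp1.
case/andP=> _ path2 /and3P[_ /hasPn dis uniq2] yl.
have : ucycle e (y :: rcons p2 z).
  rewrite /ucycle /= rcons_path path2 last_rcons ezy uniq2 /= andbT.
  by apply/negP => /dis; rewrite -lastp1 mem_last.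
by move/e_acyclic; case: p2 yl {path2 dis uniq2} => [|? ?]; rewrite /= ?eqxx ?size_rcons.
Qed.

(** [s] will be the root, which no switch may move. If [s] has an edge, walk away from [s]; if it
    has none, no leaf can be [s]. *)
Lemma forest_leaf s a b : e a b ->
  exists z y, [/\ z != s, e z y & forall y', e z y' -> y' = y].
Proof.
have leaf c t : e c t -> exists z y, [/\ z != c, e z y & forall y', e z y' -> y' = y].
  move=> ect; apply: (@path_end_leaf c [::] t); rewrite /= ?ect //.
  by rewrite inE andbT; apply: contraTneq ect => ->; rewrite e_irr.
move=> eab; case: (pickP (e s)) => [t /leaf //|none].
have [z [y [_ ezy leafz]]] := leaf a b eab.
by exists z, y; split=> //; apply: contraTneq ezy => ->; rewrite none.
Qed.

End ForestLeaf.

Lemma card_pairs (A B : finType) (P : pred A) (Q : A -> pred B) :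
  #|[set x : A * B | P x.1 && Q x.1 x.2]| = \sum_(a | P a) #|[set b | Q a b]|.
Proof.
rewrite -sum1_card (eq_bigl (fun x : A * B => P x.1 && Q x.1 x.2)); last first.
  by move=> x; rewrite inE.
rewrite -(pair_big_dep P Q (fun _ _ => 1)) /=; apply: eq_bigr => a _.
by rewrite -sum1_card; apply: eq_bigl => b; rewrite inE.
Qed.

Lemma card_bigcup_le (I V : finType) (P : pred I) (F : I -> {set V}) m :
  (forall i, P i -> #|F i| <= m) -> #|\bigcup_(i | P i) F i| <= #|[set i | P i]| * m.
Proof.
move=> Fm; apply: (@leq_trans (\sum_(i | P i) m)).
  elim/big_rec2: _ => [|i n A Pi leA]; first by rewrite cards0.
  by apply: leq_trans (leq_card_setU _ _) _; exact: leq_add (Fm i Pi) leA.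
rewrite sum_nat_const leq_eqVlt; apply/orP; left; apply/eqP; congr (_ * _).
by apply: eq_card => i; rewrite inE.
Qed.

(** * Switching in rooted spanning copies, and their spread *)

Section Switching.
Variables (V : finType) (T G : sgraph V) (x : V) (D d : nat).
Hypothesis T_acyclic : acyclic T.
Hypothesis T_degree : forall u, degree T u <= D.
Hypothesis G_codegree : forall a, #|[set b | ~~ G a b]| <= d.

Implicit Types (s : {perm V}) (Y : {set {set V}}).

Definition preserves_edges s := [forall a, forall b, T a b ==> G (s a) (s b)].

(** After relabelling, [T] and [G] share their vertex set and the root of [T] is [x], so a spanning
    copy is a permutation fixing [x]. *)
Definition rooted_copies := [set s : {perm V} | (s x == x) && preserves_edges s].

Definition image_edges s := [set [set s ab.1; s ab.2] | ab : V * V & T ab.1 ab.2].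

Definition copies_with Y := [set s in rooted_copies | Y \subset image_edges s].

Lemma image_edgesP s (f : {set V}) :
  reflect (exists c c', T c c' /\ f = [set s c; s c']) (f \in image_edges s).
Proof.
apply: (iffP imsetP) => [[[c c']] | [c [c' [Tcc' ->]]]].
  by rewrite inE /= => Tcc' ->; exists c, c'.
by exists (c, c'); rewrite ?inE.
Qed.

Lemma mem_image_edges s c c' : ([set s c; s c'] \in image_edges s) = T c c'.
Proof.
apply/image_edgesP/idP => [[c1 [c2 [T12 eq12]]]|Tcc']; last by exists c, c'.
have eqc : [set c; c'] = [set c1; c2].
  by apply: (imset_inj (@perm_inj _ s)); rewrite !imsetU !imset_set1.
have : c1 \in [set c; c'] by rewrite eqc set21.
have : c2 \in [set c; c'] by rewrite eqc set22.
rewrite !in_set2 => /orP[]/eqP E2 /orP[]/eqP E1; move: T12; rewrite E1 E2 ?adj_irr //.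
by rewrite adj_sym.
Qed.

(* Composing [s] with the transposition of [u] and [w] moves only the edges at
   [u] and [w]; [switchable] says that their new images are edges of [G]. *)
Definition switchable s u w :=
  [forall y, T u y ==> G (s y) (s w)] && [forall z, T w z ==> G (s z) (s u)].

Definition switch s u w : {perm V} := (tperm u w * s)%g.

Lemma switchD s u w c : c != u -> c != w -> switch s u w c = s c.
Proof. by move=> cu cw; rewrite permM tpermD // eq_sym. Qed.

Lemma switchL s u w : switch s u w u = s w.
Proof. by rewrite permM tpermL. Qed.

Lemma switchR s u w : switch s u w w = s u.
Proof. by rewrite permM tpermR. Qed.

Lemma switchable_edge s u w : switchable s u w -> T u w = false.
Proof.
case/andP=> _ /forallP/(_ u)/implyP Gu; apply/negP => Tuw.
by have := Gu; rewrite adj_sym adj_irr => /(_ Tuw).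
Qed.

Lemma switch_edge_touching s u w a b : switchable s u w -> T a b ->
  (a == u) || (a == w) -> G (switch s u w a) (switch s u w b).
Proof.
move=> sw; have nT := switchable_edge sw.
case/andP: sw => /forallP Gu /forallP Gw Tab /orP[]/eqP ea; rewrite {a}ea in Tab *.
  have bu : b != u by apply: contraTneq Tab => ->; rewrite adj_irr.
  have bw : b != w by apply: contraTneq Tab => ->; rewrite nT.
  by rewrite switchL switchD // adj_sym; apply: (implyP (Gu b)).
have bw : b != w by apply: contraTneq Tab => ->; rewrite adj_irr.
have bu : b != u by apply: contraTneq Tab => ->; rewrite adj_sym nT.
by rewrite switchR switchD // adj_sym; apply: (implyP (Gw b)).
Qed.

Lemma switch_edge s u w a b : switchable s u w -> T a b ->
  G (switch s u w a) (switch s u w b) \/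
  (switch s u w a = s a /\ switch s u w b = s b).
Proof.
move=> sw Tab; case: (boolP ((a == u) || (a == w))) => [ta|].
  by left; exact: switch_edge_touching.
case: (boolP ((b == u) || (b == w))) => [tb _|].
  by left; rewrite adj_sym; apply: switch_edge_touching; rewrite // adj_sym.
by rewrite !negb_or => /andP[bu bw] /andP[au aw]; right; rewrite !switchD.
Qed.

(** [w] fails either because [s w] is a non-neighbour of [s y] for one of the at most [D] neighbours
    [y] of [u], or because [w] is a neighbour of some [z] with [s z] among the at most [d]
    non-neighbours of [s u]. *)
Lemma card_unswitchable s u : #|[set w | ~~ switchable s u w]| <= (D * d).*2.
Proof.
pose A := \bigcup_(y | T u y) [set w | ~~ G (s y) (s w)].
pose B := \bigcup_(z | ~~ G (s u) (s z)) [set w | T z w].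
have cA : #|A| <= D * d.
  apply: leq_trans (card_bigcup_le (m := d) _) _ => [y _|].
    apply: leq_trans (G_codegree (s y)); rewrite -(card_imset _ (@perm_inj _ s)).
    by apply/subset_leq_card/subsetP => c /imsetP[w]; rewrite inE => ? ->; rewrite inE.
  by rewrite leq_mul2r T_degree orbT.
have cB : #|B| <= D * d.
  rewrite mulnC; apply: leq_trans (card_bigcup_le (m := D) _) _ => [z _|].
    exact: T_degree.
  rewrite leq_mul2r; apply/orP; right.
  apply: leq_trans (G_codegree (s u)); rewrite -(card_imset _ (@perm_inj _ s)).
  by apply/subset_leq_card/subsetP => c /imsetP[w]; rewrite inE => ? ->; rewrite inE.
rewrite -addnn; apply: leq_trans (leq_add cA cB).
apply: leq_trans (leq_card_setU A B); apply/subset_leq_card/subsetP => w.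
rewrite !inE negb_and => /orP[]/forallPn[y]; rewrite negb_imply => /andP[Ty Gy].
  by apply/orP; left; apply/bigcupP; exists y; rewrite ?inE.
by apply/orP; right; apply/bigcupP; exists y; rewrite ?inE 1?adj_sym.
Qed.

(** Induction on the number of edges of [T] not mapped to edges of [G]: a switch at an end of such
    an edge repairs it and spoils no other. *)
Lemma rooted_copy_exists s0 : s0 x = x -> (D * d).*2.+1 < #|V| ->
  exists s, s \in rooted_copies.
Proof.
move=> + large; pose bad s := [set ab : V * V | T ab.1 ab.2 && ~~ G (s ab.1) (s ab.2)].
have [n] := ubnP #|bad s0|; elim: n s0 => // n IH s0 lt_n s0x.
have [bad0|[[a b]]] := set_0Vmem (bad s0).
  exists s0; rewrite inE s0x eqxx; apply/forallP => a; apply/forallP => b.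
  apply/implyP => Tab; apply/negPn/negP => nG.
  by have := in_set0 (a, b); rewrite -bad0 inE Tab nG.
rewrite inE /= => /andP[Tab nGab].
(* Switch at an end other than the root, so that the root stays fixed. *)
have [u [u' [ux Tuu' nG]]] : exists u u', [/\ u != x, T u u' & ~~ G (s0 u) (s0 u')].
  have [ax|ax] := eqVneq a x; last by exists a, b.
  exists b, a; rewrite adj_sym Tab adj_sym nGab; split=> //.
  by apply: contraTneq Tab => ->; rewrite ax adj_irr.
have [w] : exists w, w \notin x |: [set w | ~~ switchable s0 u w].
  apply/existsP; rewrite -negb_forall; apply: contraL large => /forallP all_in.
  rewrite -leqNgt -cardsT; apply: (@leq_trans #|x |: [set w | ~~ switchable s0 u w]|).
    by apply/subset_leq_card/subsetP => w _.
  by rewrite cardsU1 -add1n leq_add ?leq_b1 ?card_unswitchable.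
rewrite !inE negb_or negbK => /andP[wx sw].
apply: (IH (switch s0 u w)); last by rewrite switchD // eq_sym.
apply: (@leq_trans #|bad s0|) => //; apply/proper_card/properP; split.
  apply/subsetP => -[c c']; rewrite !inE /= => /andP[Tcc' nGcc']; rewrite Tcc' /=.
  by case: (switch_edge sw Tcc') => [Gcc'|[<- <-] //]; rewrite Gcc' in nGcc'.
exists (u, u'); rewrite inE /= Tuu' //= negbK.
by apply: switch_edge_touching; rewrite ?eqxx.
Qed.

(** Double counting. In a copy containing [Y], the vertex [u] mapped to the leaf [b] can be switched
    with many [w] mapped outside [cover Y], which keeps all other edges of [Y]. The old copy is
    recovered from the new one and [u], a [T]-neighbour of the preimage of [a], for which there are
    at most [D] choices. *)
Lemma card_copies_leaf Y a b : [set a; b] \in Y -> a != b -> b != x ->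
  (forall f, f \in Y -> b \in f -> f = [set a; b]) ->
  #|copies_with Y| * (#|V| - #|cover Y| - (D * d).*2.+1) <=
  #|copies_with (Y :\ [set a; b])| * D.
Proof.
move=> abY ab bx leafb.
pose ok (s : {perm V}) w := [&& switchable s (s^-1 b)%g w, w != x & s w \notin cover Y].
pose old := [set sw : {perm V} * V | (sw.1 \in copies_with Y) && ok sw.1 sw.2].
pose new := [set su : {perm V} * V |
  (su.1 \in copies_with (Y :\ [set a; b])) && T (su.1^-1 a)%g su.2].
have card_new : #|new| <= #|copies_with (Y :\ [set a; b])| * D.
  have -> : #|new| = _ := card_pairs (mem (copies_with (Y :\ [set a; b])))
    (fun (s : {perm V}) u => T (s^-1 a)%g u).
  by rewrite -sum_nat_const; apply: leq_sum => s _; exact: T_degree.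
have card_old : #|copies_with Y| * (#|V| - #|cover Y| - (D * d).*2.+1) <= #|old|.
  have -> : #|old| = _ := card_pairs (mem (copies_with Y)) ok.
  rewrite -sum_nat_const; apply: leq_sum => s _.
  pose Z := s @^-1: cover Y :|: (x |: [set w | ~~ switchable s (s^-1 b)%g w]).
  have cZ : #|Z| <= #|cover Y| + (D * d).*2.+1.
    apply: leq_trans (leq_card_setU _ _) _; apply: leq_add.
      rewrite -(card_imset _ (@perm_inj _ s)); apply/subset_leq_card/subsetP => c.
      by case/imsetP=> w; rewrite inE => ? ->.
    by rewrite cardsU1 -add1n leq_add ?leq_b1 ?card_unswitchable.
  rewrite -subnDA leq_subLR; apply: (@leq_trans #|~: Z :|: Z|).
    by rewrite setUC setUCr cardsT.
  apply: leq_trans (leq_card_setU _ _) _; rewrite addnC; apply: leq_add => //.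
  apply/subset_leq_card/subsetP => w; rewrite !inE /ok !negb_or negbK.
  by case/and3P=> -> -> ->.
apply: leq_trans card_old (leq_trans _ card_new).
pose h (sw : {perm V} * V) := (switch sw.1 (sw.1^-1 b)%g sw.2, (sw.1^-1 b)%g).
have h_inj : injective h.
  move=> [s w] [s' w'] [eqs equ].
  have sE (t : {perm V}) v : switch (switch t (t^-1 b)%g v) (t^-1 b)%g v = t.
    by rewrite /switch mulgA tperm2 mul1g.
  have wE (t : {perm V}) v : ((switch t (t^-1 b) v)^-1 b = v)%g.
    by apply: (@perm_inj _ (switch t (t^-1 b)%g v)); rewrite permKV switchR permKV.
  have eqw : w = w' by rewrite -(wE s w) -(wE s' w') eqs.
  by rewrite -(sE s w) eqs equ eqw sE.
rewrite -(card_imset _ h_inj); apply/subset_leq_card/subsetP => _ /imsetP[[s w] + ->].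
rewrite inE /= => /andP[]; rewrite !inE => /andP[/andP[/eqP sx /forallP pres] /subsetP Ysub].
case/and3P=> sw wx wY; set u := (s^-1 b)%g in sw *.
have su : s u = b by rewrite permKV.
have ux : u != x by apply: contraNneq bx => ux; rewrite -su ux sx.
have wcov c f : f \in Y -> s c \in f -> c != w.
  by move=> fY scf; apply: contraNneq wY => <-; apply/bigcupP; exists f.
(* Only [u] and [w] are moved, where [s u = b] and [s w] is outside [cover Y]; hence the edges of
   [Y] avoiding [b] stay in place. *)
have keep c f : f \in Y -> s c \in f -> s c != b -> switch s u w c = s c.
  move=> fY scf cb; apply: switchD; last exact: wcov scf.
  by apply: contraNneq cb => ->; rewrite su.
have sa : (switch s u w)^-1%g a = (s^-1 a)%g.
  apply: (@perm_inj _ (switch s u w)); rewrite permKV (keep _ _ abY) permKV //.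
  by rewrite set21.
rewrite /= sa switchD 1?eq_sym // sx eqxx /=; apply/andP; split; last first.
  by rewrite -(mem_image_edges s) permKV su; exact: Ysub.
apply/andP; split.
  apply/forallP => c; apply/forallP => c'; apply/implyP => Tcc'.
  by case: (switch_edge sw Tcc') => [//|[-> ->]]; apply: (implyP (forallP (pres c) c')).
apply/subsetP => f; rewrite !inE => /andP[nf fY].
have nbf : b \notin f by apply: contraNN nf => bf; rewrite (leafb f).
have /image_edgesP[c [c' [Tcc' fE]]] := Ysub f fY.
have kc t : s t \in f -> switch s u w t = s t.
  by move=> tf; apply: (keep _ _ fY) => //; apply: contraNneq nbf => <-.
by rewrite fE -kc ?fE ?set21 // -[s c']kc ?fE ?set22 // mem_image_edges.
Qed.

Lemma copies_with_set0 : copies_with set0 = rooted_copies.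
Proof. by apply/setP => s; rewrite inE sub0set andbT. Qed.

Lemma copies_withS Y Y' : Y \subset Y' -> copies_with Y' \subset copies_with Y.
Proof.
move=> YY'; apply/subsetP => s; rewrite !inE => /andP[-> Y's].
exact: subset_trans Y's.
Qed.

Lemma card_cover_copies Y s : s \in copies_with Y -> #|cover Y| <= #|Y|.*2.
Proof.
rewrite inE => /andP[_ /subsetP Ys]; apply: leq_trans (leq_card_cover Y) _.
rewrite -muln2 -sum_nat_const; apply: leq_sum => f /Ys /image_edgesP[c [c' [_ ->]]].
by rewrite cards2; case: eqP.
Qed.

(** Pulled back along [s], the edges in [Y] form a subgraph of [T], hence a forest, which has a leaf
    other than [x]. *)
Lemma copies_leaf Y s f0 : s \in copies_with Y -> f0 \in Y ->
  exists a b, [/\ [set a; b] \in Y, a != b, b != x &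
    forall f, f \in Y -> b \in f -> f = [set a; b]].
Proof.
rewrite 2!inE => /andP[/andP[/eqP sx _] /subsetP Ys] f0Y.
pose e c c' := T c c' && ([set s c; s c'] \in Y).
have e_sym : symmetric e by move=> c c'; rewrite /e adj_sym setUC.
have e_irr : irreflexive e by move=> c; rewrite /e adj_irr.
have e_acyclic c : ucycle e c -> size c <= 2.
  case/andP=> cyc unic; apply: T_acyclic; rewrite /ucycle unic andbT.
  by apply: sub_cycle cyc => c1 c2 /andP[].
have [c [c' [Tcc' f0E]]] := image_edgesP s f0 (Ys f0 f0Y).
have ecc' : e c c' by rewrite /e Tcc' -f0E.
have [z [y [zx /andP[Tzy zyY] leafz]]] := forest_leaf e_sym e_irr e_acyclic x ecc'.
exists (s y), (s z); split; first by rewrite setUC.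
- by rewrite (inj_eq perm_inj); apply: contraTneq Tzy => ->; rewrite adj_irr.
- by rewrite -[X in _ != X]sx (inj_eq perm_inj).
move=> f fY; have [c1 [c2 [T12 fE]]] := image_edgesP s f (Ys f fY); rewrite fE in fY *.
rewrite !inE !(inj_eq perm_inj) => /orP[]/eqP zE.
  by rewrite zE in leafz *; rewrite -(leafz c2) 1?setUC // /e T12.
by rewrite zE in leafz *; rewrite -(leafz c1) // /e adj_sym T12 setUC.
Qed.

Lemma card_cover_leaf Y a b : [set a; b] \in Y ->
  (forall f, f \in Y -> b \in f -> f = [set a; b]) ->
  #|cover (Y :\ [set a; b])| < #|cover Y|.
Proof.
move=> abY leafb; apply/proper_card/properP; split.
  apply/subsetP => c /bigcupP[f]; rewrite !inE => /andP[_ fY] cf.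
  by apply/bigcupP; exists f.
exists b; first by apply/bigcupP; exists [set a; b]; rewrite ?set22.
by apply/bigcupP => -[f]; rewrite !inE => /andP[/eqP nf fY] /(leafb f fY).
Qed.

Local Open Scope ring_scope.

(* While [Y] covers at most [t] vertices, enough switchable vertices remain and
   removing a leaf edge gains a factor [q]; beyond that nothing is gained. *)
Lemma card_copies_with (R : realFieldType) (q : R) (t : nat) Y :
  0 < q <= 1 -> (t + (D * d).*2.+1 < #|V|)%N ->
  D%:R <= q * (#|V| - t - (D * d).*2.+1)%:R ->
  #|copies_with Y|%:R * q ^+ (#|cover Y| - t) <= #|rooted_copies|%:R * q ^+ #|Y|.
Proof.
case/andP=> q0 q1 large Dq; have [n] := ubnP #|Y|; elim: n Y => // n IH Y lt_n.
have [Y0|[f fY]] := set_0Vmem Y.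
  by rewrite Y0 copies_with_set0 /cover big_set0 !cards0 sub0n.
have [NY0|[s sY]] := set_0Vmem (copies_with Y).
  by rewrite NY0 cards0 mul0r mulr_ge0 // exprn_ge0 // ltW.
have [a [b [abY ab bx leafb]]] := copies_leaf sY fY.
have cYE : #|Y| = #|Y :\ [set a; b]|.+1 by rewrite (cardsD1 [set a; b] Y) abY.
have {IH} := IH (Y :\ [set a; b]); rewrite -cYE => /(_ lt_n) IH.
have lt_cov := card_cover_leaf abY leafb.
rewrite cYE exprSr mulrA; apply: le_trans (ler_wpM2r (ltW q0) IH).
rewrite -mulrA -exprSr.
have [small|big] := leqP #|cover Y| t.
  have -> : (#|cover Y| - t = 0)%N by apply/eqP.
  have -> : (#|cover (Y :\ [set a; b])| - t = 0)%N.
    by apply/eqP; rewrite subn_eq0; apply: leq_trans small; exact: ltnW.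
  rewrite expr0 mulr1 expr1.
  have gap0 : 0 < (#|V| - t - (D * d).*2.+1)%:R :> R by rewrite ltr0n -subnDA subn_gt0.
  have := card_copies_leaf abY ab bx leafb.
  have gap_le : (#|V| - t - (D * d).*2.+1 <= #|V| - #|cover Y| - (D * d).*2.+1)%N.
    by rewrite leq_sub2r // leq_sub2l.
  move/(leq_trans (leq_mul (leqnn _) gap_le)); rewrite -(ler_nat R) !natrM => step.
  rewrite -(ler_pM2r gap0); apply: le_trans step _; rewrite -mulrA.
  by apply: ler_wpM2l.
(* Dropping an edge cannot decrease the number of copies, and the missing factor [q] is paid for by
   the loss of the leaf from the covered vertices. *)
apply: ler_pM; rewrite ?exprn_ge0 ?(ltW q0) //.
  by rewrite ler_nat; apply/subset_leq_card/copies_withS/subD1set.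
apply: ler_wiXn2l; rewrite ?(ltW q0) //; exact: ltn_sub2r.
Qed.

(** Each copy contains some [Y] in [U], so the sets [copies_with Y] together exhaust the copies, and
    the spread bounds each of them. *)
Lemma cover_cost_ge1 (R : realFieldType) (q : R) U : rooted_copies != set0 ->
  (forall Y, #|copies_with Y|%:R <= #|rooted_copies|%:R * q ^+ #|Y|) ->
  covers U (image_edges @: rooted_copies) -> 1 <= cost q U.
Proof.
move=> ne spread cov.
have I0 : 0 < #|rooted_copies|%:R :> R by rewrite ltr0n card_gt0.
rewrite -(ler_pM2l I0) mulr1 /cost mulr_sumr.
apply: le_trans (ler_sum _ (fun Y _ => spread Y)); rewrite -natr_sum ler_nat.
apply: leq_trans (_ : #|\bigcup_(Y in U) copies_with Y| <= _)%N; last first.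
  elim/big_rec2: _ => [|Y m A _ leA]; first by rewrite cards0.
  by apply: leq_trans (leq_card_setU _ _) _; rewrite leq_add2l.
apply/subset_leq_card/subsetP => s sI; have [Y YU Ys] := cov _ (imset_f image_edges sI).
by apply/bigcupP; exists Y; rewrite // inE sI.
Qed.

End Switching.

Local Open Scope ring_scope.

(** * Passage to [G_p] and relabelling of the tree *)

Lemma prob_GpE (R : realFieldType) (W : finType) (G : sgraph W) (p : R) (A : pred (sgraph W)) :
  prob_Gp G p A = expect (only (edges G) p) (fun S => (A (keep G S))%:R).
Proof.
rewrite /expect [RHS](bigID (fun S : {set {set W}} => (S \subset edges G) && A (keep G S))) /=.
rewrite [X in _ + X]big1 ?addr0 => [|S].
  apply: eq_bigr => S /andP[SG ->]; rewrite mulr1 /weight [RHS](bigID (mem (edges G))) /=.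
  rewrite [X in _ * X]big1 ?mulr1 => [|e eG].
    by apply: eq_bigr => e eG; rewrite /only eG.
  by rewrite /only (negbTE eG) (contraNF (subsetP SG e) eG) subr0.
rewrite negb_and => /orP[/subsetPn[e eS eG]|/negbTE ->]; last by rewrite mulr0.
by rewrite /weight (bigD1 e) //= eS /only (negbTE eG) !mul0r.
Qed.

Lemma prob_Gp_ge (R : realFieldType) (W : finType) (G : sgraph W) (p : R)
    (A : pred (sgraph W)) (H : {set {set {set W}}}) : 0 <= p <= 1 ->
  (forall (S F : {set {set W}}), F \in H -> F \subset S -> A (keep G S)) ->
  1 - evasion (edges G) H p <= prob_Gp G p A.
Proof.
move=> p01 HA; rewrite prob_GpE lerBlDr -expectD -[leLHS](expect_cst (only (edges G) p)).
apply: ler_expect => [e|S]; first exact: only01.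
rewrite -natrD (ler_nat R 1); case: (boolP (avoids H S)) => [_|]; first by rewrite addn1.
by case/forall_inPn=> F FH; rewrite negbK => /(HA S F FH) ->.
Qed.

Lemma rooted_bijection (V W : finType) (v : V) (x : W) : #|V| = #|W| ->
  exists (f : V -> W) (g : W -> V), [/\ cancel f g, cancel g f & f v = x].
Proof.
move=> eqVW; pose f0 u := enum_val (cast_ord eqVW (enum_rank u)).
pose g0 w := enum_val (cast_ord (esym eqVW) (enum_rank w)).
have fK : cancel f0 g0 by move=> u; rewrite /f0 /g0 enum_valK cast_ordK enum_rankK.
have gK : cancel g0 f0 by move=> w; rewrite /f0 /g0 enum_valK cast_ordKV enum_rankK.
exists (tperm (f0 v) x \o f0), (g0 \o tperm (f0 v) x); split; last by rewrite /= tpermL.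
- by move=> u /=; rewrite tpermK fK.
- by move=> w /=; rewrite gK tpermK.
Qed.

Section Relabel.
Variables (V W : finType) (T : sgraph V) (f : V -> W) (g : W -> V).
Hypotheses (fK : cancel f g) (gK : cancel g f).

Definition relabel_adj : rel W := fun a b => T (g a) (g b).

Lemma relabel_sym : symmetric relabel_adj.
Proof. by move=> a b; rewrite /relabel_adj adj_sym. Qed.

Lemma relabel_irr : irreflexive relabel_adj.
Proof. by move=> a; rewrite /relabel_adj adj_irr. Qed.

Definition relabel : sgraph W := SGraph relabel_sym relabel_irr.

Lemma relabel_acyclic : acyclic T -> acyclic relabel.
Proof.
move=> acyc c /andP[cyc unic]; rewrite -(size_map g); apply: acyc.
by rewrite /ucycle cycle_map (map_inj_uniq (can_inj gK)) unic andbT.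
Qed.

Lemma degree_relabel a : degree relabel a = degree T (g a).
Proof.
rewrite /degree -(card_imset _ (can_inj gK)); apply: eq_card => u.
rewrite inE; apply/imsetP/idP => [[b]|Tu]; first by rewrite inE => ? ->.
by exists (f u); rewrite ?inE /= /relabel_adj fK.
Qed.

Lemma embeds_relabel G (v : V) (S : {set {set W}}) s :
  s \in rooted_copies relabel G (f v) -> image_edges relabel s \subset S ->
  embeds_rooted T v (f v) (keep G S).
Proof.
rewrite inE => /andP[/eqP sx /forallP pres] /subsetP sub.
apply/existsP; exists [ffun u => s (f u)]; rewrite ffunE sx eqxx andbT.
apply/andP; split.
  by apply/injectiveP => u u'; rewrite !ffunE => /perm_inj /(can_inj fK).
apply/forallP => u; apply/forallP => w; apply/implyP => Tuw; rewrite !ffunE /=.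
have Tfuw : relabel (f u) (f w) by rewrite /= /relabel_adj !fK.
rewrite /keep_adj sub ?mem_image_edges // andbT.
exact: (implyP (forallP (pres (f u)) (f w))).
Qed.

End Relabel.

Lemma min_degree_le (V : finType) (G : sgraph V) u : (min_degree G <= degree G u)%N.
Proof.
rewrite /min_degree; have := mem_index_enum u.
elim: (index_enum V) => // w r IH; rewrite inE big_cons geq_min.
by case/orP=> [/eqP -> | /IH ->]; rewrite ?leqnn ?orbT.
Qed.

Lemma card_nonadjacent (V : finType) (G : sgraph V) a :
  (#|[set b | ~~ G a b]| <= #|V| - min_degree G)%N.
Proof.
have -> : #|[set b | ~~ G a b]| = (#|V| - degree G a)%N.
  by rewrite -[#|V|](cardsC [set b | G a b]) addKn; apply: eq_card => b; rewrite !inE.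
by rewrite leq_sub2l // min_degree_le.
Qed.

Lemma edges_sub (V : finType) (T G : sgraph V) x s :
  s \in rooted_copies T G x -> image_edges T s \subset edges G.
Proof.
rewrite inE => /andP[_ /forallP pres]; apply/subsetP => f.
case/image_edgesP => c [c' [Tcc' ->]]; apply/imsetP; exists (s c, s c') => //.
by rewrite inE; apply: (implyP (forallP (pres c) c')).
Qed.

Lemma card_image_edges (V : finType) (T : sgraph V) s :
  (#|image_edges T s| <= #|V| ^ 2)%N.
Proof.
by apply: leq_trans (leq_imset_card _ _) _; apply: leq_trans (max_card _) _;
   rewrite card_prod.
Qed.

(** * Logarithmic estimates and the choice of constants *)

Section Numerics.
Variable R : realType.
Implicit Types (n D d k r : nat).

Local Notation L n := (ln (n%:R : R)).

Lemma ln_natr_large (C : R) : exists n0, forall n, (n0 <= n)%N -> C <= L n /\ (0 < n)%N.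
Proof.
exists (Num.truncn (expR C)).+1 => n le_n.
have eC : expR C <= n%:R.
  apply/ltW/(lt_le_trans (truncnS_gt _)); rewrite ler_nat //.
have n0 : 0 < n%:R :> R := lt_le_trans (expR_gt0 C) eC.
by split; rewrite -?(ltr0n R) // -ler_expR lnK.
Qed.

(** Follows from [expR y >= 1 + y ^ 2 / 2] at [y = L n]. *)
Lemma natr_ln_ge n : 0 < L n -> L n / 2 <= n%:R / L n.
Proof.
move=> L0; have n0 : 0 < n%:R :> R.
  by rewrite ltNge; apply: contraTN L0 => /ln0 ->; rewrite ltxx.
rewrite ler_pdivlMr //; have := expR_ge1Dxn 1 (ltW L0); rewrite lnK //.
by rewrite (_ : 2`! = 2)%N // expr2; lra.
Qed.

(** [n ^ 2] bounds the number of edges of a copy. The factor 5 comes from [ln 2 >= 1 / 2], which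
    gives 4, and from rounding up, absorbed by [1 <= L n]. *)
Lemma exists_pow2 n : 1 <= L n -> (0 < n)%N ->
  exists k, [/\ (0 < k)%N, (n ^ 2 < 2 ^ k)%N & k%:R <= 5 * L n].
Proof.
move=> L1 n0; have nR : 0 < n%:R :> R by rewrite ltr0n.
exists (trunc_log 2 (n ^ 2)).+1; split=> //; first exact: trunc_log_ltn.
have := @trunc_logP 2 (n ^ 2) isT; rewrite expn_gt0 n0 => /(_ isT).
set k := trunc_log _ _; rewrite -(ler_nat R) !natrX => le_pow.
have ln2 : 2^-1 <= ln (2 : R).
  have : ln (2^-1 : R) <= - 2^-1.
    have {1}-> : 2^-1 = 1 + - 2^-1 :> R by field.
    by apply: le_ln1Dx; lra.
  by rewrite lnV ?posrE // lerN2.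
have : ln (2 ^+ k : R) <= ln (n%:R ^+ 2) by rewrite ler_ln // posrE exprn_gt0.
rewrite !lnXn // mulr2n -[leLHS]mulr_natl -[k.+1%:R]natr1 => le_ln.
have := ler_wpM2l (ler0n R k) ln2; lra.
Qed.

End Numerics.

(** Take [t = n - r] in [card_copies_with]. Its correction matters only if [Y] covers more than
    [n - r >= n / 2] vertices, so [#|Y| > n / 4]; it is then at least [n ^- r >= expR (- 3 * n)],
    which a factor [expR 12] per edge outweighs. *)
Lemma edge_spread (R : realType) (W : finType) (T G : sgraph W) (x : W)
    (D d r : nat) (L : R) (Y : {set {set W}}) :
  acyclic T -> (forall u, degree T u <= D)%N ->
  (forall a, #|[set b | ~~ G a b]| <= d)%N ->
  L = ln #|W|%:R -> 6 <= L -> 1 <= D%:R * L -> D%:R * L <= #|W|%:R ->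
  r%:R <= 3 * #|W|%:R / L -> #|W|%:R / L <= (r - (D * d).*2.+1)%:R ->
  #|copies_with T G x Y|%:R <=
    #|rooted_copies T G x|%:R * (expR 12 * (D%:R * L / #|W|%:R)) ^+ #|Y|.
Proof.
move=> acyc degT codeg LE L6 DL1 DLn rL gap; set n := #|W| in LE DLn rL gap *.
have L0 : 0 < L by lra.
have n0 : 0 < n%:R :> R by lra.
set q := D%:R * L / n%:R.
have q0 : 0 < q by rewrite divr_gt0 //; lra.
have q1 : q <= 1 by rewrite ler_pdivrMr // mul1r.
have r_half : r%:R <= n%:R / 2 :> R.
  apply: (le_trans rL); rewrite ler_pdivrMr //; have := ler_wpM2l (ltW n0) L6; lra.
have rn : (r <= n)%N by rewrite -(ler_nat R); lra.
have gap0 : (0 < r - (D * d).*2.+1)%N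
  by rewrite -(ltr0n R); apply: lt_le_trans gap; exact: divr_gt0.
have subE : (n - (n - r) = r)%N by rewrite subKn.
have e1 : 1 <= expR 12 :> R by rewrite -[leLHS]expR0 ler_expR.
have [NY0|[s sY]] := set_0Vmem (copies_with T G x Y).
  by rewrite NY0 cards0 mulr_ge0 // exprn_ge0 // mulr_ge0 ?expR_ge0 // ltW.
have := @card_copies_with _ T G x D d acyc degT codeg _ q (n - r) Y.
rewrite -/n subE q0 q1 => /(_ isT) bound.
have {}bound : #|copies_with T G x Y|%:R * q ^+ (#|cover Y| - (n - r)) <=
    #|rooted_copies T G x|%:R * q ^+ #|Y|.
  apply: bound.
    by rewrite -ltn_subRL subE -subn_gt0.
  rewrite ?subE; apply: le_trans (ler_wpM2l (ltW q0) gap).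
  by rewrite le_eqVlt; apply/orP; left; apply/eqP; rewrite /q; field; rewrite !gt_eqF.
rewrite exprMn mulrCA -ler_pdivrMl ?exprn_gt0 ?expR_gt0 // mulrC.
apply: le_trans bound; apply: ler_wpM2l => //.
have [small|big] := leqP #|cover Y| (n - r).
  have -> : (#|cover Y| - (n - r) = 0)%N by apply/eqP.
  by rewrite expr0 invf_le1 ?exprn_gt0 ?expR_gt0 // exprn_ege1.
have cn : (#|cover Y| <= n)%N by exact: max_card.
have jr : (#|cover Y| - (n - r) <= r)%N by rewrite -[leqRHS]subE leq_sub2r.
apply: (@le_trans _ _ (q ^+ r)); last first.
  by apply: ler_wiXn2l; rewrite ?(ltW q0).
apply: (@le_trans _ _ ((n%:R^-1) ^+ r)); last first.
  apply: lerXn2r; rewrite ?nnegrE ?invr_ge0 ?(ltW n0) ?(ltW q0) //.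
  by rewrite -[leLHS]mul1r ler_wpM2r // invr_ge0 ltW.
rewrite exprVn lef_pV2 ?posrE ?exprn_gt0 ?expR_gt0 //.
rewrite -[n%:R](@lnK R) ?posrE // -/n -LE -!expRM_natl ler_expR.
have := card_cover_copies sY; move/(leq_trans big); rewrite ltn_subLR //.
rewrite -(ltr_nat R) natrD -addnn natrD.
have := rL; rewrite ler_pdivlMr //; lra.
Qed.

(* The reserve [r] of vertices kept available for switching. *)
Lemma exists_reserve (R : realType) (n D d : nat) (L : R) : 8 <= L ->
  L / 2 <= n%:R / L -> (0 < D)%N -> d%:R <= n%:R / (D%:R * L ^+ 5) ->
  exists r : nat, r%:R <= 3 * n%:R / L /\ n%:R / L <= (r - (D * d).*2.+1)%:R.
Proof.
move=> L8 yL D0 dle; have L0 : 0 < L by lra.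
have DR : 0 < D%:R :> R by rewrite ltr0n.
set y := n%:R / L in yL *; have y4 : 4 <= y by lra.
(* With [y >= 4], this [r] lies between [2 * y] and [3 * y], and [2 * D * d + 1 <= y / 2 + 1 <= y]
   leaves at least [y]. *)
exists (Num.truncn (2 * y)).+1.
have r_gt := truncnS_gt (2 * y).
have r_le : (Num.truncn (2 * y))%:R <= 2 * y by rewrite truncn_le; lra.
split; first by rewrite -mulrA -/y -natr1; lra.
have Dd : (D * d)%:R <= y / 4.
  rewrite natrM; apply: (le_trans (ler_wpM2l (ltW DR) dle)).
  have -> : D%:R * (n%:R / (D%:R * L ^+ 5)) = y / L ^+ 4.
    by rewrite /y; field; rewrite !gt_eqF.
  rewrite ler_wpM2l ?lef_pV2 ?posrE ?exprn_gt0 //; first lra.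
  have L1 : 1 <= L by lra.
  apply: (@le_trans _ _ L); [lra | exact: ler_eXnr].
have DdE : ((D * d).*2.+1)%:R = 2 * (D * d)%:R + 1 :> R.
  by rewrite -natr1 -mul2n natrM.
rewrite natrB; first by rewrite DdE; lra.
by rewrite -(ler_nat R) DdE; lra.
Qed.

Theorem theorem3p2 (R : realType) :
  exists n0 : nat,
  forall (n Delta : nat) (V W : finType) (T : sgraph V) (G : sgraph W)
         (v : V) (x : W) (p : R),
    (n0 <= n)%N ->
    is_tree T ->
    #|V| = n ->
    max_degree T = Delta ->
    #|leaves T|%:R <= n%:R / (ln (n%:R : R)) ^+ 3 ->
    #|W| = n ->
    (min_degree G)%:R >= n%:R - n%:R / (Delta%:R * (ln (n%:R : R)) ^+ 5) ->
    0 <= p <= 1 ->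
    p >= Delta%:R * (ln (n%:R : R)) ^+ 5 / n%:R ->
    prob_Gp G p (embeds_rooted T v x) >= 1 - n%:R ^- 3.
Proof.
(* [2000 = 16 * 5 ^ 3]: as [k <= 5 * L], the condition [16 * k ^ 3 * q <= p] of [threshold] follows
   from [2000 * expR 12 <= L]. *)
have [n0 large] := ln_natr_large (2000 * expR 12 : R).
exists n0 => n D V W T G v x p /large[LC n_gt0] [_ _ acyc] cV degT _ cW minG p01 p_ge.
set L := ln _ in LC minG p_ge.
have e12 : 1 <= expR 12 :> R by rewrite -[leLHS]expR0 ler_expR.
have L8 : 8 <= L by lra.
have L0 : 0 < L by lra.
have nR : 0 < n%:R :> R by rewrite ltr0n.
have minG_n : (min_degree G < n)%N.
  apply: leq_ltn_trans (min_degree_le G x) _; rewrite -cW -cardsT; apply: proper_card.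
  by apply/properP; split; [exact: subsetT | exists x; rewrite ?inE // adj_irr].
(* For [D = 0] division by zero returns 0, and [minG] would force minimum degree [n]. *)
have D0 : (0 < D)%N.
  rewrite lt0n; apply: contraTneq minG => ->.
  by rewrite mul0r invr0 mulr0 subr0 ler_nat -ltnNge.
have DR : 1 <= D%:R :> R by rewrite ler1n.
set d := (n - min_degree G)%N.
have d_le : d%:R <= n%:R / (D%:R * L ^+ 5) by rewrite natrB ?(ltnW minG_n) //; lra.
(* Since [p <= 1], the lower bound on [p] limits [D]. *)
have DL5 : D%:R * L ^+ 5 <= n%:R.
  by case/andP: p01 => _ /(le_trans p_ge); rewrite ler_pdivrMr // mul1r.
have L1 : 1 <= L by lra.
have DL : 1 <= D%:R * L by apply: (le_trans L1); exact: ler_peMl (ltW L0) DR.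
have DLn : D%:R * L <= n%:R.
  by apply: le_trans DL5; rewrite ler_wpM2l ?ler_eXnr //; lra.
have p0 : 0 < p by apply: lt_le_trans p_ge; rewrite divr_gt0 // mulr_gt0 ?exprn_gt0 //; lra.
have [f [g [fK gK fv]]] := rooted_bijection v x (etrans cV (esym cW)).
have [k [k0 nk k_le]] := exists_pow2 L1 n_gt0.
have qp : 16 * k%:R ^+ 3 * (expR 12 * (D%:R * L / n%:R)) <= p.
  apply: le_trans p_ge.
  have -> : D%:R * L ^+ 5 / n%:R = L ^+ 4 * (D%:R * L / n%:R) by ring.
  rewrite mulrA ler_wpM2r ?divr_ge0 //; first lra.
  have k3 : k%:R ^+ 3 <= (5 * L) ^+ 3 by apply: lerXn2r; rewrite ?nnegrE //; lra.
  have := ler_wpM2r (exprn_ge0 3 (ltW L0)) LC; rewrite -exprS.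
  have := ler_wpM2r (expR_ge0 12) k3; rewrite exprMn; lra.
have q0 : 0 <= expR 12 * (D%:R * L / n%:R).
  by rewrite mulr_ge0 ?expR_ge0 // divr_ge0 //; lra.
have L6 : 6 <= L by lra.
have L3n : 3 * n%:R <= n%:R * L by rewrite [leLHS]mulrC ler_wpM2l //; lra.
have [r [r_le r_ge]] := exists_reserve L8 (natr_ln_ge L0) D0 d_le.
have room : ((D * d).*2.+1 < #|W|)%N.
  rewrite cW; apply: (@leq_trans r).
    by rewrite -subn_gt0 -(ltr0n R); apply: lt_le_trans r_ge; exact: divr_gt0.
  by rewrite -(ler_nat R); apply: (le_trans r_le); rewrite ler_pdivrMr.
pose T' := relabel T g.
have acyc' : acyclic T' by exact: relabel_acyclic.
have degT' u : (degree T' u <= D)%N.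
  by rewrite (degree_relabel T fK gK) -degT; exact: leq_bigmax.
have codeg a : (#|[set b | ~~ G a b]| <= d)%N.
  by rewrite /d -cW; exact: card_nonadjacent.
set q := expR 12 * _ in qp q0.
have spread Y : #|copies_with T' G x Y|%:R <= #|rooted_copies T' G x|%:R * q ^+ #|Y|.
  by rewrite /q -cW; apply: (@edge_spread _ _ _ _ _ _ d r); rewrite ?cW.
pose H := image_edges T' @: rooted_copies T' G x.
have ev : evasion (edges G) H p <= 4 ^- k.
  apply: (threshold (q := q)) => //.
  - by rewrite p0; case/andP: p01.
  - by move=> S /imsetP[s sI ->]; exact: edges_sub sI.
  - move=> S /imsetP[s _ ->]; apply: leq_ltn_trans (card_image_edges T' s) _.
    by rewrite cW.
  - move=> U cov; apply: (@cover_cost_ge1 _ T' G x _ q U) => //.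
    have [s sI] := @rooted_copy_exists _ T' G x D d degT' codeg 1%g (perm1 x) room.
    by apply/set0Pn; exists s.
have : 1 - 4 ^- k <= prob_Gp G p (embeds_rooted T v x).
  apply: le_trans (prob_Gp_ge (H := H) p01 _); first by rewrite lerD2l lerN2.
  move=> S F /imsetP[s sI ->]; rewrite -fv in sI *; exact: embeds_relabel.
apply: le_trans; rewrite lerD2l lerN2 lef_pV2 ?posrE ?exprn_gt0 //.
have -> : 4 = 2 ^+ 2 :> R by rewrite expr2 -natrM.
(* [n ^ 3 <= (n ^ 2) ^ 2 <= (2 ^ k) ^ 2 = 4 ^ k]. *)
rewrite exprAC -!natrX ler_nat; apply: (@leq_trans ((n ^ 2) ^ 2)).
  by rewrite -expnM leq_pexp2l.
by rewrite leq_exp2r // ltnW.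
Qed.
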